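(* The nIP and nNIPG DG methods are stable: there exist constants $\kappa>0$ and $C_s>0$, independent of $h$ and $\delta$, such that whenever the penalty parameter satisfies $\mu\ge\kappa\rho^{-1}$, the bilinear form $B_h=E+J+\mu P$ (with $J$ that of nIP or of nNIPG) satisfies $$B_h(v_h,v_h)\ge C_s\,|||v_h|||^2,\qquad\forall v_h\in V_h.$$
   Context: **Setting.** $\Omega=(a,b)$, $\delta>0$, $\Omega_\delta=[a-\delta,a]\cup[b,b+\delta]$, $\widetilde\Omega=\Omega\cup\Omega_\delta$. The kernel $\gamma_\delta$ is nonnegative, even, $s^2\gamma_\delta(s)\in L^1_{loc}(\mathbb{R})$, and normalized by $\int_{-\delta}^{\delta}s^2\gamma_\delta(s)\,ds=1$. All functions are extended by zero outside $\widetilde\Omega$; $E_s^+w(x)=w(x+s)-w(x)$. **Mesh and space.** The mesh consists of intervals $I_j=(x_{j-1/2},x_{j+1/2})$, $j=-m+1,\dots,N+m$, with $x_{1/2}=a$, $x_{N+1/2}=b$, $x_{-m+1/2}\le a-\delta<x_{-m+3/2}$, $x_{N+m-1/2}<b+\delta\le x_{N+m+1/2}$. Put $h_j=x_{j+1/2}-x_{j-1/2}$, $h=\max_j h_j$, $\rho=\min_j h_j$. The mesh is regular: $\nu h\le\rho$ for a fixed constant $\nu>0$ (constants may depend on $\nu$ and $k$). $V_h=\{v\in L^2(\widetilde\Omega): v|_{I_j}\in\mathcal{P}_k(I_j),\ j=1,\dots,N,\ v|_{\Omega_\delta}=0\}$, where $\mathcal P_k(I_j)$ is the space of polynomials of degree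 at most $k$ on $I_j$. Sums $\sum_j$ run over all mesh indices. Set $\hat h=\min\{\rho,\delta\}$, $I_{j,2}^s=(x_{j+1/2}-s,x_{j+1/2})$, and $[\![w]\!]_{j+1/2}=w(x_{j+1/2}^+)-w(x_{j+1/2}^-)$. **Bilinear forms.** Let $g_v(x,s)=E_s^+v(x)-[\![v]\!]_{j+1/2}$ if $x\in I_{j,2}^s$ and $s\in(0,\hat h)$, and $g_v(x,s)=E_s^+v(x)$ otherwise. Define $$E(u,v)=2\int_0^\delta\gamma_\delta(s)\sum_j\int_{I_j}g_u(x,s)g_v(x,s)\,dx\,ds,\qquad P(u,v)=\int_0^{\hat h}s^2\gamma_\delta(s)\,ds\ \sum_j[\![u]\!]_{j+1/2}[\![v]\!]_{j+1/2},$$ $$K(u,v)=2\sum_j[\![v]\!]_{j+1/2}\int_0^{\hat h}\gamma_\delta(s)\int_{I_{j,2}^s}g_u(x,s)\,dx\,ds.$$ nIP: $J(u,v)=K(u,v)+K(v,u)$; nNIPG: $J(u,v)=K(u,v)-K(v,u)$. **Norm.** $|v|_{E,h}^2=E(v,v)$, $|v|_{J,h}^2=2\sum_j h_j\int_0^{\hat h}\gamma_\delta(s)\frac1s\int_{I_{j,2}^s}g_v(x,s)^2\,dx\,ds$, $|v|_{P,h}^2=P(v,v)$, and $|||v|||^2=|v|_{E,h}^2+|v|_{J,h}^2+\mu|v|_{P,h}^2$. *)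

(* Defs.v *)
(* MathComp-Analysis *)
From HB Require Import structures.
From mathcomp Require Import all_boot all_order all_algebra.
From mathcomp Require Import all_classical all_reals all_analysis.
Set Implicit Arguments.
Unset Strict Implicit.
Unset Printing Implicit Defensive.
Import Order.TTheory GRing.Theory Num.Theory.
Import numFieldNormedType.Exports.
Local Open Scope classical_set_scope.
Local Open Scope ring_scope.

Notation leb := lebesgue_measure.

Definition is_kernel (R : realType) (delta : R) (gamma : R -> R) : Prop :=
  [/\ forall s, 0 <= gamma s,
      forall s, gamma (- s) = gamma s,
      locally_integrable setT (fun s => s ^+ 2 * gamma s) &
      \int[leb]_(s in `[- delta, delta]) (s ^+ 2 * gamma s) = 1].

(* The m cells on the left of a, the N cells of (a, b) and the m cells on the
   right of b are numbered from 0: [node i] is $x_{i-m+1/2}$ and the cell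
   (node i, node i.+1) is $I_{i-m+1}$, for i < N + 2m.  The values of [node]
   beyond N + 2m are irrelevant.  The inequalities force m > 0 and N > 0 when
   a < b and delta > 0. *)
Record mesh (R : realType) (a b delta : R) := Mesh {
  mesh_m : nat;
  mesh_N : nat;
  node : nat -> R;
  mesh_size := (mesh_N + mesh_m.*2)%N;
  node_incr : forall i, (i < mesh_size)%N -> node i < node i.+1;
  node_a : node mesh_m = a;
  node_b : node (mesh_m + mesh_N) = b;
  node_left : node 0 <= a - delta < node 1;
  node_right : node mesh_size.-1 < b + delta <= node mesh_size
}.

Section DG.
Context (R : realType) (a b delta : R).
Implicit Types (M : mesh a b delta) (gamma u v : R -> R) (mu : R).

Definition cell M (j : nat) : set R := `]node M j, node M j.+1[.

Definition width M (j : nat) : R := node M j.+1 - node M j.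

Definition hmax M : R :=
  \big[Order.max/width M 0]_(j < mesh_size M) width M j.

Definition rho M : R :=
  \big[Order.min/width M 0]_(j < mesh_size M) width M j.

Definition hhat M : R := Order.min (rho M) delta.

(* $I_{j,2}^s$ *)
Definition cell2 M (j : nat) (s : R) : set R :=
  `]node M j.+1 - s, node M j.+1[.

Definition Omega_delta : set R := `[a - delta, a] `|` `[b, b + delta].

Definition Omega_tilde : set R := `]a, b[ `|` Omega_delta.

(* Elements of $V_h$ are represented by functions on the whole line, extended
   by zero outside [Omega_tilde], that are polynomial on each open cell of
   (a, b); the values at the interior nodes are unconstrained, and none of the
   forms below depends on them. *)
Definition Vh M (k : nat) : set (R -> R) := [set v |
  [/\ (v : measurableTypeR R -> R) \in Lfun (@leb R) 2%:E,
      forall j, (mesh_m M <= j < mesh_m M + mesh_N M)%N ->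
        exists2 p : {poly R}, (size p <= k.+1)%N &
          forall y, cell M j y -> v y = p.[y],
      forall y, Omega_delta y -> v y = 0 &
      forall y, ~ Omega_tilde y -> v y = 0]].

(* The jump of w at the right end point of cell j, from one-sided limits. *)
Definition jump M (w : R -> R) (j : nat) : R :=
  lim (w y @[y --> (node M j.+1)^'+]) - lim (w y @[y --> (node M j.+1)^'-]).

Definition shift_diff (s : R) (w : R -> R) (y : R) : R := w (y + s) - w y.

(* $g_v(y, s)$ for y in cell j *)
Definition g M v (j : nat) (y s : R) : R :=
  if (y \in cell2 M j s) && (0 < s < hhat M)
  then shift_diff s v y - jump M v j
  else shift_diff s v y.

Definition E_form M gamma u v : R :=
  2 * \int[leb]_(s in `]0, delta[) (gamma s *
    \sum_(j < mesh_size M) \int[leb]_(y in cell M j) (g M u j y s * g M v j y s)).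

Definition P_form M gamma u v : R :=
  (\int[leb]_(s in `]0, hhat M[) (s ^+ 2 * gamma s)) *
  \sum_(j < mesh_size M) (jump M u j * jump M v j).

Definition K_form M gamma u v : R :=
  2 * \sum_(j < mesh_size M) (jump M v j *
    \int[leb]_(s in `]0, hhat M[) (gamma s *
      \int[leb]_(y in cell2 M j s) g M u j y s)).

Definition J_nIP M gamma u v : R := K_form M gamma u v + K_form M gamma v u.

Definition J_nNIPG M gamma u v : R := K_form M gamma u v - K_form M gamma v u.

Definition B_nIP M gamma mu u v : R :=
  E_form M gamma u v + J_nIP M gamma u v + mu * P_form M gamma u v.

Definition B_nNIPG M gamma mu u v : R :=
  E_form M gamma u v + J_nNIPG M gamma u v + mu * P_form M gamma u v.

(* Squares of the (semi)norms. *)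
Definition normE2 M gamma v : R := E_form M gamma v v.

Definition normJ2 M gamma v : R :=
  2 * \sum_(j < mesh_size M) (width M j *
    \int[leb]_(s in `]0, hhat M[) (gamma s * s^-1 *
      \int[leb]_(y in cell2 M j s) (g M v j y s ^+ 2))).

Definition normP2 M gamma v : R := P_form M gamma v v.

Definition triple_norm2 M gamma mu v : R :=
  normE2 M gamma v + normJ2 M gamma v + mu * normP2 M gamma v.

End DG.

(* Main.v *)
Require Import Defs.
From HB Require Import structures.
From mathcomp Require Import all_boot all_order all_algebra.
From mathcomp Require Import all_classical all_reals all_analysis.
From mathcomp Require Import measurable_realfun polyrcf ring lra zify.
Import Order.TTheory GRing.Theory Num.Theory.
Import numFieldNormedType.Exports.
Set Implicit Arguments.
Unset Strict Implicit.
Local Open Scope classical_set_scope.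
Local Open Scope ring_scope.

(** On the part [cell2] of a cell, [g] is a sum of two differences of polynomials
    over distances at most [s], so its square is at most [s^2] times the squared
    Lipschitz constants of the two adjacent pieces.  Conversely, by equivalence
    of norms on polynomials of bounded degree, each piece has a subinterval of
    length proportional to the cell on which differences at distance [s] are at
    least [s] times a fixed fraction of its Lipschitz constant; this bounds the
    inner integral of E from below as long as [s <= r * rho].  For [s > r * rho]
    the weight [h_j / s] is bounded and the integrand of the J-seminorm is
    already part of that of E.  Hence the J-seminorm is controlled by the
    E-seminorm, and by Young's inequality |K(v, v)| is at most
    [eps * |v|_J^2 + |v|_P^2 / (2 * eps * rho)], which is absorbed. *)

(** * Polynomials *)

Lemma poly_diff_le (R : rcfType) (p : {poly R}) (L x y : R) :
  x <= y -> (forall z, x <= z <= y -> `|p^`().[z]| <= L) ->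
  `|p.[y] - p.[x]| <= L * (y - x).
Proof.
rewrite le_eqVlt => /predU1P[-> _|xy hL]; first by rewrite !subrr normr0 mulr0.
have [c cI ->] := poly_mvt p xy; move: cI; rewrite in_itv/= => /andP[xc cy].
rewrite normrM (@gtr0_norm _ (y - x)) ?subr_gt0// ler_wpM2r//.
  by rewrite subr_ge0 ltW.
by apply: hL; rewrite !ltW.
Qed.

Lemma norm_horner_le (R : realDomainType) (n : nat) (p : {poly R}) (z : R) :
  (size p <= n)%N -> 0 <= z <= 1 -> `|p.[z]| <= \sum_(i < n) `|p`_i|.
Proof.
move=> pn /andP[z0 z1]; rewrite (horner_coef_wide _ pn).
apply: le_trans (ler_norm_sum _ _ _) _; apply: ler_sum => i _.
by rewrite normrM ler_piMr// normrX ger0_norm// exprn_ile1.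
Qed.

(* The Vandermonde matrix of n distinct nodes of [0, 1] is invertible. *)
Lemma coef_le_horner (R : realFieldType) (n : nat) :
  exists2 C : R, 0 < C & forall p : {poly R}, (size p <= n.+1)%N ->
    exists2 z, 0 <= z <= 1 & \sum_(i < n.+1) `|p`_i| <= C * `|p.[z]|.
Proof.
pose t : 'rV[R]_n.+1 := \row_j (j%:R / n.+1%:R).
pose V := Vandermonde n.+1 t.
have Vu : V \in unitmx.
  rewrite unitmxE det_Vandermonde unitfE; apply/prodf_neq0 => i _.
  apply/prodf_neq0 => j ij; rewrite !mxE -mulrBl mulf_neq0 ?invr_eq0 ?pnatr_eq0//.
  by rewrite subr_eq0 eqr_nat gtn_eqF.
(* The coefficients are the node values times [W], so the sum of the absolute entries of [W] times
   the largest node value bounds them. The summand 1 only makes [C] positive. *)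
pose W := invmx V; pose C := 1 + \sum_(i < n.+1) \sum_(j < n.+1) `|W j i|.
have C0 : 0 < C.
  by rewrite ltr_pwDl// sumr_ge0// => i _; rewrite sumr_ge0.
exists C => // p pn.
pose c : 'rV[R]_n.+1 := \row_i p`_i.
have cV j : (c *m V) 0 j = p.[t 0 j].
  rewrite mxE (horner_coef_wide _ pn); apply: eq_bigr => i _.
  by rewrite !mxE.
pose j0 := [arg max_(j > (ord0 : 'I_n.+1)) `|p.[t 0 j]|]%O.
have hj0 j : `|p.[t 0 j]| <= `|p.[t 0 j0]|.
  by rewrite /j0; case: arg_maxP => // i _ /(_ j isT).
exists (t 0 j0).
  rewrite mxE divr_ge0//= ler_pdivrMr ?ltr0n// mul1r ler_nat.
  by apply: ltnW.
apply: (@le_trans _ _ (\sum_(i < n.+1) \sum_(j < n.+1) `|W j i| * `|p.[t 0 j0]|)).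
  apply: ler_sum => i _.
  have -> : p`_i = \sum_j p.[t 0 j] * W j i.
    have -> : p`_i = (c *m V *m W) 0 i by rewrite mulmxK// mxE.
    rewrite mxE.
    by apply: eq_bigr => j _; rewrite cV.
  apply: le_trans (ler_norm_sum _ _ _) _; apply: ler_sum => j _.
  by rewrite normrM mulrC ler_wpM2l.
under eq_bigr do rewrite -mulr_suml.
by rewrite -mulr_suml ler_wpM2r// /C lerDr.
Qed.

(** A Markov-type inequality in the coefficient norm: differentiation multiplies each coefficient by
    its index. It is applied to a first derivative, in order to bound the second one. *)
Lemma deriv_coef_sum_le (R : realDomainType) (n : nat) (p : {poly R}) :
  (size p <= n.+1)%N ->
  \sum_(i < n.+1) `|p^`()`_i| <= n.+1%:R * \sum_(i < n.+1) `|p`_i|.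
Proof.
move=> pn; rewrite big_ord_recr/= coef_deriv nth_default// mul0rn normr0 addr0.
rewrite (big_ord_recl n (fun i : 'I_n.+1 => `|p`_i|)) mulrDr.
rewrite -[leLHS]add0r lerD ?mulr_ge0// mulr_sumr ler_sum// => i _.
rewrite coef_deriv normrMn lift0 -[leLHS]mulr_natl ler_wpM2r// ler_nat.
by rewrite ltnS ltnW.
Qed.

(** The same [L] has to serve in the upper and in the lower estimate, up to the factor [c]; the
    coefficient sum of the derivative does so. The window has length [2 * r] so that a point of its
    first half, translated by at most [r], stays in it. *)
Lemma poly_diff_unit (R : rcfType) (n : nat) :
  exists c r : R, [/\ 0 < c, 0 < r & forall p : {poly R}, (size p <= n.+1)%N ->
    exists L : R, [/\ 0 <= L,
      forall x y : R, 0 <= x -> x <= y -> y <= 1 -> `|p.[y] - p.[x]| <= L * (y - x) &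
      exists alpha : R, [/\ 0 <= alpha, alpha + 2 * r <= 1 &
        forall x y : R, alpha <= x -> x <= y -> y <= alpha + 2 * r ->
          c * L * (y - x) <= `|p.[y] - p.[x]|]]].
Proof.
have [C C0 hC] := @coef_le_horner R n.
(* [p^`()] reaches [L / C] at some [z0], and [p^`()^`()] is at most [K * L], so
   [p^`()] stays within [L / (2 * C)] of its value at [z0] at distance [w]. *)
pose K : R := n.+1%:R; have K0 : 0 < K by rewrite ltr0n.
have CK0 : 0 < C * K by rewrite mulr_gt0.
(* The summand 1 gives [w <= 1/2], so that a window of length [w] fits in the unit interval on one
   side of [z0]; the summand [C * K] gives [K * w <= 1 / (2 * C)]. *)
pose w : R := (2 * (1 + C * K))^-1.
have w0 : 0 < w by rewrite invr_gt0; lra.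
have wE : 2 * w * (1 + C * K) = 1 by rewrite /w; field; apply: lt0r_neq0; lra.
have w12 : w <= 2^-1 by nra.
have wC : K * w <= (2 * C)^-1.
  rewrite -(ler_pM2l C0).
  have -> : C * (2 * C)^-1 = 2^-1 by field; exact: lt0r_neq0.
  nra.
exists (2 * C)^-1, (w / 2); split => //; first by rewrite invr_gt0 mulr_gt0.
  by rewrite divr_gt0.
move=> p pn; pose L := \sum_(i < n.+1) `|p^`()`_i|.
have L0 : 0 <= L by rewrite sumr_ge0.
have dpn : (size p^`() <= n.+1)%N.
  by rewrite (leq_trans (size_poly _ _))// (leq_trans (leq_pred _)).
have ddpn : (size p^`()^`() <= n.+1)%N.
  by rewrite (leq_trans (size_poly _ _))// (leq_trans (leq_pred _)).
exists L; split => //.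
  move=> x y x0 xy y1; apply: poly_diff_le => // z /andP[xz zy].
  apply: norm_horner_le => //; apply/andP; split; lra.
have [z0 /andP[z00 z01] hz0] := hC _ dpn.
have lip2 x y : 0 <= x -> x <= y -> y <= 1 ->
    `|p^`().[y] - p^`().[x]| <= K * L * (y - x).
  move=> x0 xy y1; apply: poly_diff_le => // z /andP[xz zy].
  apply: le_trans (deriv_coef_sum_le dpn).
  apply: norm_horner_le => //; apply/andP; split; lra.
rewrite mulrCA divff ?mulr1; last by rewrite pnatr_eq0.
have main alpha : 0 <= alpha -> alpha + w <= 1 -> alpha <= z0 <= alpha + w ->
    forall x y : R, alpha <= x -> x <= y -> y <= alpha + w ->
    (2 * C)^-1 * L * (y - x) <= `|p.[y] - p.[x]|.
  move=> a0 aw1 /andP[az0 z0a] x y ax xy yw.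
  have near z : x <= z <= y -> `|p^`().[z] - p^`().[z0]| <= (2 * C)^-1 * L.
    move=> /andP[xz zy].
    have H (u v : R) : alpha <= u -> u <= v -> v <= alpha + w ->
        `|p^`().[v] - p^`().[u]| <= (2 * C)^-1 * L.
      move=> au uv va; apply: le_trans (lip2 _ _ _ _ _) _; try lra.
      rewrite -mulrA (mulrC L) mulrA ler_wpM2r//; nra.
    have [zz|zz] := leP z z0; last by apply: H; lra.
    by rewrite distrC; apply: H; lra.
  (* Removing the linear part of slope p'(z0) leaves a polynomial whose derivative is at most
     [L / (2 * C)] on the window. The difference of [p] therefore deviates from p'(z0) (y - x),
     which is at least [L / C * (y - x)] in size, by at most half of that amount. *)
  pose Q := p - p^`().[z0] *: 'X.
  have := @poly_diff_le _ Q ((2 * C)^-1 * L) x y xy.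
  rewrite /Q !poly.derivE !hornerE => hQ.
  have {}hQ : `|(p.[y] - p^`().[z0] * y) - (p.[x] - p^`().[z0] * x)|
      <= (2 * C)^-1 * L * (y - x).
    by apply: hQ => z xzy; rewrite !hornerE; apply: near.
  move: hQ.
  set d := p.[y] - p.[x] => hQ.
  have {hQ} : `|p^`().[z0] * (y - x)| <= `|d| + (2 * C)^-1 * L * (y - x).
    rewrite -lerBlDl; apply: le_trans _ hQ.
    rewrite -[X in _ <= `|X|]opprK normrN.
    apply: le_trans (lerB_dist _ _) _.
    rewrite (_ : _ - d = - (p.[y] - p^`().[z0] * y - (p.[x] - p^`().[z0] * x)))//.
    by rewrite /d; ring.
  rewrite normrM (@ger0_norm _ (y - x)); last by lra.
  have : C^-1 * L <= `|p^`().[z0]| by rewrite ler_pdivrMl.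
  rewrite invfM => h1 h2.
  have h3 : C^-1 * L * (y - x) <= `|p^`().[z0]| * (y - x).
    by rewrite ler_wpM2r//; lra.
  lra.
(* The window starts at [z0] when [z0] lies in the left half and ends at [z0] otherwise. *)
have [z0h|z0h] := leP z0 2^-1.
  exists z0; split => //; first by lra.
  by apply: main => //; lra.
exists (z0 - w); split; try lra.
by apply: main; lra.
Qed.

(** The affine map from the unit interval to the cell divides [L] by [h] and leaves [c] and [r]
    unchanged. These two thus depend on the degree only, which is the source of uniformity in the
    mesh. *)
Lemma poly_diff_cell (R : rcfType) (n : nat) :
  exists c r : R, [/\ 0 < c, 0 < r &
    forall (p : {poly R}) (x0 h : R), (size p <= n.+1)%N -> 0 < h ->
    exists L : R, [/\ 0 <= L,
      forall x y : R, x0 <= x -> x <= y -> y <= x0 + h ->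
        `|p.[y] - p.[x]| <= L * (y - x) &
      exists alpha : R, [/\ x0 <= alpha, alpha + 2 * r * h <= x0 + h &
        forall x y : R, alpha <= x -> x <= y -> y <= alpha + 2 * r * h ->
          c * L * (y - x) <= `|p.[y] - p.[x]|]]].
Proof.
have [c [r [c0 r0 H]]] := @poly_diff_unit R n.
exists c, r; split => // p x0 h pn h0.
pose q := p \Po (x0%:P + h *: 'X).
have qn : (size q <= n.+1)%N.
  apply: leq_trans (size_comp_poly_leq _ _) _; rewrite ltnS.
  have sX : ((size (x0%:P + h *: 'X)%R).-1 <= 1)%N.
    rewrite -subn1 leq_subLR (leq_trans (size_polyD _ _))// geq_max.
    rewrite (leq_trans (size_polyC_leq1 _))//=.
    by rewrite (leq_trans (size_scale_leq _ _))// size_polyX.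
  rewrite (leq_trans (leq_mul (leqnn _) sX))// muln1 -ltnS.
  by rewrite (leq_trans (leqSpred _))//; case: (size p) pn.
have qE z : p.[z] = q.[(z - x0) / h].
  rewrite /q horner_comp !(hornerD, hornerZ, hornerX, hornerC); congr (_.[_]).
  by field; exact: lt0r_neq0.
have hz z y : (z - x0) / h - (y - x0) / h = (z - y) / h by ring.
have [L [L0 Llip [a [a0 a1 Ha]]]] := H q qn.
exists (L / h); split; first by rewrite divr_ge0// ltW.
  move=> x y hx xy hy; rewrite !qE; apply: le_trans (Llip _ _ _ _ _) _.
  - by rewrite divr_ge0//; lra.
  - by rewrite ler_pM2r ?invr_gt0//; lra.
  - by rewrite ler_pdivrMr//; lra.
  - by rewrite hz mulrAC -mulrA.
exists (x0 + a * h); split; first by rewrite lerDl mulr_ge0// ltW.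
  by rewrite -addrA lerD2l -mulrDl -[leRHS]mul1r ler_wpM2r// ltW.
move=> x y hx xy hy; rewrite !qE.
apply: le_trans (_ : c * L * ((y - x0) / h - (x - x0) / h) <= _).
  by rewrite hz; rewrite le_eqVlt; apply/orP; left; apply/eqP; ring.
apply: Ha.
- by rewrite ler_pdivlMr//; lra.
- by rewrite ler_pM2r ?invr_gt0//; lra.
- by rewrite ler_pdivrMr// mulrDl; lra.
Qed.

(** * Functions of V_h cell by cell *)

Section Mesh.
Context {R : realType} {a b delta : R}.
Variable M : mesh a b delta.
Local Notation n := (mesh_size M).

Lemma mesh_size_gt0 : a < b -> (0 < n)%N.
Proof.
move=> ab; rewrite lt0n; apply/eqP => n0; move: n0; rewrite /mesh_size => n0.
have m0 : mesh_m M = 0%N by lia.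
have N0 : mesh_N M = 0%N by lia.
have Ea := node_a M; have Eb := node_b M; rewrite m0 in Ea; rewrite m0 N0 in Eb.
by move: ab; rewrite -[X in X < _]Ea Eb ltxx.
Qed.

Lemma node_le i j : (i <= j)%N -> (j <= n)%N -> node M i <= node M j.
Proof.
elim: j => [|j IH]; first by rewrite leqn0 => /eqP->.
rewrite leq_eqVlt => /predU1P[->//|]; rewrite ltnS => ij jn.
exact: le_trans (IH ij (ltnW jn)) (ltW (node_incr jn)).
Qed.

Lemma width_gt0 j : (j < n)%N -> 0 < width M j.
Proof. by move=> jn; rewrite subr_gt0 node_incr. Qed.

Lemma node_succE j : node M j.+1 = node M j + width M j.
Proof. by rewrite /width addrC subrK. Qed.

Lemma rho_le_width j : (j < n)%N -> rho M <= width M j.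
Proof. by move=> jn; rewrite /rho (bigD1 (Ordinal jn))//= ge_min lexx. Qed.

Lemma width_le_hmax j : (j < n)%N -> width M j <= hmax M.
Proof. by move=> jn; rewrite /hmax (bigD1 (Ordinal jn))//= le_max lexx. Qed.

Lemma rho_gt0 : a < b -> 0 < rho M.
Proof.
move=> ab; rewrite /rho; elim/big_ind : _ => [|x y x0 y0|i _].
- exact/width_gt0/mesh_size_gt0.
- by rewrite lt_min x0.
- exact: width_gt0.
Qed.

Lemma hhat_le_rho : hhat M <= rho M.
Proof. by rewrite ge_min lexx. Qed.

Lemma hhat_le_delta : hhat M <= delta.
Proof. by rewrite ge_min lexx orbT. Qed.

Lemma hhat_gt0 : a < b -> 0 < delta -> 0 < hhat M.
Proof. by move=> ab d0; rewrite lt_min rho_gt0. Qed.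

Lemma cell_or_node y : node M 0 < y < node M n ->
  exists2 j, (j < n)%N & cell M j y \/ y = node M j.
Proof.
move=> /andP[y0]; have : (n <= n)%N by [].
elim: {1 3}n => [_|j IH jn yj]; first by move/(lt_trans y0); rewrite ltxx.
have [yj'|yj'|->] := ltgtP y (node M j).
- exact: IH (ltnW jn) yj'.
- by exists j => //; left; rewrite /cell/= in_itv/= yj'.
- by exists j => //; right.
Qed.

End Mesh.

Section Pieces.
Context {R : realType} {a b delta : R}.
Variables (M : mesh a b delta) (k : nat) (v : R -> R).
Hypothesis hv : Vh M k v.
Local Notation n := (mesh_size M).

Lemma Vh_outside y : y <= a \/ b <= y -> v y = 0.
Proof.
case: hv => _ _ h1 h2 hy; have [yO|] := pselect (Omega_delta a b delta y).
  exact: h1.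
move=> yO; apply: h2; case=> // /=; rewrite in_itv/= => /andP[].
by case: hy => hy h3 h4; lra.
Qed.

(** Cells outside (a, b) carry the zero polynomial. The extra index [n] stands for the exterior to
    the right of the mesh, so that [p j.+1] describes [v] beyond the right end of cell [j] even for
    the last cell. *)
Lemma Vh_pieces : exists p : nat -> {poly R}, [/\ p n = 0,
  forall i, (size (p i) <= k.+1)%N &
  forall i y, (i < n)%N -> cell M i y -> v y = (p i).[y]].
Proof.
have H i : exists p : {poly R}, (size p <= k.+1)%N /\
    ((i < n)%N -> forall y, cell M i y -> v y = p.[y]) /\ (i = n -> p = 0).
  have [ni|ni] := leqP n i.
    by exists 0; rewrite size_poly0; split => //; split => //; rewrite ltnNge ni.
  have [/andP[mi iN]|] := boolP (mesh_m M <= i < mesh_m M + mesh_N M)%N.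
    case: hv => _ /(_ i) + _ _; rewrite mi iN => /(_ isT)[p sp hp].
    by exists p; split => //; split => // ei; move: ni; rewrite ei ltnn.
  move=> out; exists 0; rewrite size_poly0; split => //; split => // _ y.
  rewrite /cell/= in_itv/= => /andP[y1 y2]; rewrite horner0; apply: Vh_outside.
  have mN : (mesh_m M + mesh_N M <= n)%N by rewrite /mesh_size; lia.
  have [im|im] := ltnP i (mesh_m M).
    left; apply: le_trans (ltW y2) _; rewrite -[leRHS](node_a M).
    by apply: node_le => //; lia.
  right; apply: le_trans (ltW y1); rewrite -[leLHS](node_b M); apply: node_le; lia.
have [p hp] := choice H.
exists p; split; first by case: (hp n) => _ [_]; exact.
  by move=> i; case: (hp i).
by move=> i y iN; case: (hp i) => _ [/(_ iN)/(_ y)].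
Qed.

Hypothesis d0 : 0 < delta.

Lemma Vh_right y : node M n <= y -> v y = 0.
Proof.
move=> ny; apply: Vh_outside; right; apply: le_trans ny.
by case/andP: (node_right M) => _; apply: le_trans; rewrite lerDl ltW.
Qed.

Lemma Vh_left y : y <= node M 0 -> v y = 0.
Proof.
move=> ny; apply: Vh_outside; left; apply: (le_trans ny).
by case/andP: (node_left M) => + _; move/le_trans; apply; rewrite gerBl ltW.
Qed.

(** The node values are counted separately, being unrelated to the pieces. The bound depends on [v]
    and serves integrability only; it enters no final constant. *)
Lemma Vh_bounded : exists B : R, forall y, `|v y| <= B.
Proof.
have [p [_ _ hp]] := Vh_pieces.
pose ub i := sval (poly_itv_bound (p i) (node M i) (node M i.+1)).
exists (\sum_(i < n) (`|ub i| + `|v (node M i)|)) => y.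
have S0 : 0 <= \sum_(i < n) (`|ub i| + `|v (node M i)|).
  by rewrite sumr_ge0// => i _; rewrite addr_ge0.
have [yl|yl] := leP y (node M 0); first by rewrite Vh_left// normr0.
have [yr|yr] := leP (node M n) y; first by rewrite Vh_right// normr0.
have [|j jn hj] := @cell_or_node _ _ _ _ M y; first by rewrite yl.
apply: (@le_trans _ _ (`|ub j| + `|v (node M j)|)); last first.
  by rewrite (bigD1 (Ordinal jn))//= lerDl sumr_ge0.
case: hj => [yj|->]; last by rewrite lerDr.
rewrite ler_wpDr// (hp _ _ jn yj); apply: le_trans (ler_norm _).
rewrite /ub; case: poly_itv_bound => u /= hu; apply: hu.
by move: yj; rewrite /cell/= !in_itv/= => /andP[? ?]; rewrite !ltW.
Qed.

End Pieces.

(** * The jumps and [g] in terms of the polynomial pieces *)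

Section Jump.
Context {R : realType} {a b delta : R}.
Variables (M : mesh a b delta) (k : nat) (v : R -> R).
Hypotheses (ab : a < b) (d0 : 0 < delta) (hv : Vh M k v).
Local Notation n := (mesh_size M).
Variable p : nat -> {poly R}.
Hypothesis pn : p n = 0.
Hypothesis vp : forall i y, (i < n)%N -> cell M i y -> v y = (p i).[y].

Lemma Vh_right_of_node j y : (j < n)%N ->
  node M j.+1 < y < node M j.+1 + rho M -> v y = (p j.+1).[y].
Proof.
move=> jn /andP[y1 y2]; have [j1n|] := ltnP j.+1 n.
  apply: vp => //; rewrite /cell/= in_itv/= y1/= (lt_le_trans y2)//.
  by rewrite (node_succE M j.+1) lerD2l rho_le_width.
move=> nj; have e : j.+1 = n by apply/eqP; rewrite eqn_leq jn.
by rewrite e pn horner0; apply: (Vh_right hv d0); rewrite -e ltW.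
Qed.

Lemma jumpE j : (j < n)%N ->
  jump M v j = (p j.+1).[node M j.+1] - (p j).[node M j.+1].
Proof.
move=> jn; rewrite /jump; congr (_ - _); apply: cvg_lim => //.
- have /cvg_at_right_filter H := @continuous_horner _ (p j.+1) (node M j.+1).
  apply: cvg_trans H; apply: near_eq_cvg; near=> y.
  apply/esym/(Vh_right_of_node jn)/andP; split; near: y; first exact: nbhs_right_gt.
  by apply: nbhs_right_lt; rewrite ltrDl rho_gt0.
- have /cvg_at_left_filter H := @continuous_horner _ (p j) (node M j.+1).
  apply: cvg_trans H; apply: near_eq_cvg; near=> y.
  apply/esym/vp => //; rewrite /cell/= in_itv/=; apply/andP; split; near: y.
    exact/nbhs_left_gt/node_incr.
  exact: nbhs_left_lt.
Unshelve. all: by end_near. Qed.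

Lemma cell2_sub j s : (j < n)%N -> s < hhat M -> cell2 M j s `<=` cell M j.
Proof.
move=> jn sh y; rewrite /cell2 /cell/= !in_itv/= => /andP[y1 ->]; rewrite andbT.
apply: lt_trans y1; have := rho_le_width jn; rewrite /width.
have := hhat_le_rho M; lra.
Qed.

(** Subtracting the jump inserts the two one-sided values at the node between [y] and [y + s], so
    each bracket involves a single piece. The bound [s < rho] keeps [y + s] from passing the
    following node. *)
Lemma g_cell2 j s y : (j < n)%N -> 0 < s -> s < hhat M -> cell2 M j s y ->
  g M v j y s = ((p j.+1).[y + s] - (p j.+1).[node M j.+1]) +
                ((p j).[node M j.+1] - (p j).[y]).
Proof.
move=> jn s0 sh yc; rewrite /g s0 sh !andbT mem_set// jumpE// /shift_diff.
rewrite (vp jn (cell2_sub jn sh yc)) (@Vh_right_of_node j (y + s))//; first by ring.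
move: yc; rewrite /cell2/= in_itv/= => /andP[y1 y2]; have := hhat_le_rho M.
move=> ?; apply/andP; split; lra.
Qed.

Lemma g_cell j s y : (j < n)%N -> 0 < s -> node M j < y -> y + s < node M j.+1 ->
  g M v j y s = (p j).[y + s] - (p j).[y].
Proof.
move=> jn s0 y1 y2; rewrite /g memNset /=; last first.
  by rewrite /cell2/= in_itv/= => /andP[]; lra.
by rewrite /shift_diff !(vp jn)// /cell/= in_itv/=; apply/andP; split; lra.
Qed.

Lemma norm_g_le (B : R) j y s : (forall x, `|v x| <= B) ->
  `|g M v j y s| <= 2 * B + `|jump M v j|.
Proof.
move=> vB; have h : `|shift_diff s v y| <= 2 * B.
  by rewrite /shift_diff (le_trans (ler_normB _ _))// mulr2n mulrDl !mul1r lerD.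
rewrite /g; case: ifP => _; last by rewrite ler_wpDr.
by rewrite (le_trans (ler_normB _ _))// lerD2r.
Qed.

End Jump.

(* The constants [L j] are Lipschitz constants of the pieces of [v]. *)
Lemma Vh_g_bounds (R : realType) (k : nat) : exists c r : R, [/\ 0 < c, 0 < r &
  forall (a b delta : R) (M : mesh a b delta) (v : R -> R),
  a < b -> 0 < delta -> Vh M k v ->
  exists L : nat -> R, [/\ L (mesh_size M) = 0, forall j, 0 <= L j,
    forall j (s y : R), (j < mesh_size M)%N -> 0 < s < hhat M -> cell2 M j s y ->
      `|g M v j y s| <= (L j + L j.+1) * s,
    forall j (s y : R), (j < mesh_size M)%N -> 0 < s ->
      node M j < y -> y + s < node M j.+1 -> `|g M v j y s| <= L j * s &
    forall j, (j < mesh_size M)%N -> exists alpha : R, [/\ node M j <= alpha,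
      alpha + 2 * r * width M j <= node M j.+1 &
      forall s y : R, 0 < s <= r * width M j ->
        alpha < y < alpha + r * width M j -> c * L j * s <= `|g M v j y s|]]].
Proof.
have [c [r [c0 r0 H]]] := @poly_diff_cell R k; exists c, r; split => //.
move=> a b delta M v ab d0 hv; have [p [pn ps vp]] := Vh_pieces hv.
set n := mesh_size M in pn vp *.
have H' j : exists L : R, (j = n -> L = 0) /\ ((j < n)%N -> [/\ 0 <= L,
  forall x y : R, node M j <= x -> x <= y -> y <= node M j.+1 ->
    `|(p j).[y] - (p j).[x]| <= L * (y - x) &
  exists alpha : R, [/\ node M j <= alpha,
    alpha + 2 * r * width M j <= node M j.+1 &
    forall x y : R, alpha <= x -> x <= y -> y <= alpha + 2 * r * width M j ->
        c * L * (y - x) <= `|(p j).[y] - (p j).[x]|]]).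
  have [jn|jn] := ltnP j n; last by exists 0.
  have [L HL] := H (p j) (node M j) (width M j) (ps j) (width_gt0 jn).
  exists L; split; last by rewrite (node_succE M j).
  by move=> e; move: jn; rewrite e ltnn.
have [L0 hL0] := choice H'.
(* Nothing is known of [L0] past index [n]; the cut-off makes [L] nonnegative at every index. *)
pose L j := if (j < n)%N then L0 j else 0.
have Lge0 j : 0 <= L j.
  by rewrite /L; case: ifP => // jn; case: (hL0 j) => _ /(_ jn)[].
have LE j : (j < n)%N -> L j = L0 j by rewrite /L => ->.
exists L; split => //; first by rewrite /L ltnn.
- move=> j s y jn /andP[s0 sh] yc; rewrite (g_cell2 ab d0 hv pn vp)// mulrDl.
  move: (yc); rewrite /cell2/= in_itv/= => /andP[y1 y2].
  have srho : s < rho M by rewrite (lt_le_trans sh)// hhat_le_rho.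
  have swj : s < width M j by rewrite (lt_le_trans srho)// rho_le_width.
  have ? := node_succE M j.
  rewrite addrC (le_trans (ler_normD _ _))// lerD//.
    rewrite LE//; case: (hL0 j) => _ /(_ jn)[L00 hL _].
    apply: le_trans (hL _ _ _ _ _) _ => //; try lra.
    by rewrite ler_wpM2l//; lra.
  have [j1n|] := ltnP j.+1 n; last first.
    move=> nj; have -> : j.+1 = n by apply/eqP; rewrite eqn_leq jn.
    by rewrite pn !horner0 subrr normr0 mulr_ge0// ltW.
  rewrite LE//; case: (hL0 j.+1) => _ /(_ j1n)[L00 hL _].
  have ? := node_succE M j.+1; have ? := rho_le_width j1n.
  apply: le_trans (hL _ _ _ _ _) _ => //; try lra.
  by rewrite ler_wpM2l//; lra.
- move=> j s y jn s0 y1 y2; rewrite (g_cell vp)// LE//.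
  case: (hL0 j) => _ /(_ jn)[L00 hL _].
  have e : y + s - y = s by ring.
  by rewrite -[X in _ <= _ * X]e; apply: hL; lra.
move=> j jn; case: (hL0 j) => _ /(_ jn)[L00 _ [al [al1 al2 hal]]].
exists al; split => // s y /andP[s0 sr] /andP[y1 y2].
rewrite LE// (g_cell vp)//; try lra.
have e : y + s - y = s by ring.
by rewrite -[X in _ * X <= _]e; apply: hal; lra.
Qed.

(** * Integrals *)

Lemma sqr_le_norm (R : realDomainType) (C t : R) : `|t| <= C -> t ^+ 2 <= C ^+ 2.
Proof.
move=> tC; rewrite -[t ^+ 2]real_normK ?num_real// lerXn2r// nnegrE.
exact: le_trans tC.
Qed.

Lemma sqr_ge_norm (R : realDomainType) (C t : R) :
  0 <= C -> C <= `|t| -> C ^+ 2 <= t ^+ 2.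
Proof. by move=> C0 Ct; rewrite -[t ^+ 2]real_normK ?num_real// lerXn2r. Qed.

Section Integrals.
Context {R : realType}.
Local Notation T := (measurableTypeR R).
Local Notation leb := (@lebesgue_measure R).
Implicit Types (A D : set R) (f h : R -> R).

Lemma Rintegral_sum A n (f : 'I_n -> R -> R) : measurable A ->
  (forall i, leb.-integrable A (EFin \o f i)) ->
  \int[leb]_(x in A) (\sum_(i < n) f i x) = \sum_(i < n) \int[leb]_(x in A) f i x.
Proof.
move=> mA; elim: n f => [|n IH] f fi.
  rewrite big_ord0; under eq_Rintegral do rewrite big_ord0.
  by rewrite Rintegral_cst// mul0r.
rewrite big_ord_recr/=; under eq_Rintegral do rewrite big_ord_recr/=.
rewrite RintegralD//; last first.
  rewrite (_ : _ \o _ = fun x =>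
      (\sum_(i < n) (EFin \o f (widen_ord (leqnSn n) i)) x)%E).
    exact: integrable_sum.
  by apply/funext => x /=; rewrite sumEFin.
by rewrite IH.
Qed.

Lemma integrable_scale A f (C : R) : measurable A ->
  leb.-integrable A (EFin \o f) -> leb.-integrable A (EFin \o (fun x => C * f x)).
Proof. by move=> mA fi; exact: (@integrableZl _ _ _ leb A mA C (EFin \o f) fi). Qed.

Lemma ge0_Rintegral_subset A D f : measurable A -> measurable D -> A `<=` D ->
  leb.-integrable D (EFin \o f) -> (forall x, D x -> 0 <= f x) ->
  \int[leb]_(x in A) f x <= \int[leb]_(x in D) f x.
Proof.
move=> mA mD AD fi f0; apply: fine_le.
- by apply: integrable_fin_num => //; exact: integrableS fi.
- exact: integrable_fin_num.
- apply: ge0_subset_integral => //; by case/integrableP : fi.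
Qed.

(* Monotonicity and the triangle inequality below hold without measurability
   because nonnegative functions are integrated by a supremum over simple
   functions. *)
Lemma ge0_le_integral_nonmeasurable A (f h : R -> \bar R) :
  (forall x, A x -> 0 <= f x)%E -> (forall x, A x -> f x <= h x)%E ->
  (\int[leb]_(x in A) f x <= \int[leb]_(x in A) h x)%E.
Proof.
move=> f0 fh; rewrite !ge0_integralE//; last first.
  by move=> x Ax; exact: le_trans (f0 _ Ax) (fh _ Ax).
apply: ereal_sup_le => _ [g gf <-]; exists g => // x.
apply: le_trans (gf x) _; rewrite !patchE.
by case: ifPn => // /set_mem; exact: fh.
Qed.

Lemma norm_Rintegral_le A f h : leb.-integrable A (EFin \o h) ->
  measurable A -> (forall x, A x -> `|f x| <= h x) ->
  `|\int[leb]_(x in A) f x| <= \int[leb]_(x in A) h x.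
Proof.
move=> hi mA fh.
(* The positive and negative parts of [f] both lie between 0 and [h], so their integrals are finite
   numbers between 0 and the integral of [h], and so is the absolute value of their difference. *)
have dist (x y I : R) : 0 <= x <= I -> 0 <= y <= I -> `|x - y| <= I.
  by move=> /andP[? ?] /andP[? ?]; rewrite ler_norml; apply/andP; split; lra.
have part (u : R -> \bar R) : (forall x, A x -> 0 <= u x <= (h x)%:E)%E ->
    exists2 r, (\int[leb]_(x in A) u x = r%:E)%E &
      0 <= r <= \int[leb]_(x in A) h x.
  move=> uh; have u0 : (0 <= \int[leb]_(x in A) u x)%E.
    by apply: integral_ge0 => x /uh/andP[].
  have hE : (\int[leb]_(x in A) (h x)%:E = (\int[leb]_(x in A) h x)%:E)%E.
    by rewrite /Rintegral fineK//; exact: integrable_fin_num.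
  have : (\int[leb]_(x in A) u x <= (\int[leb]_(x in A) h x)%:E)%E.
    by rewrite -hE; apply: ge0_le_integral_nonmeasurable => x /uh/andP[].
  case: (integral _ _ _) u0 => [r| |]//; rewrite !lee_fin => r0 rh.
  by exists r => //; rewrite r0.
rewrite {1}/Rintegral integralE.
have [x Ax|r1 -> r1h] := part (fun x => (EFin \o f)^\+ x)%E.
  rewrite funepos_ge0/= funeposE ge_max !lee_fin.
  by rewrite (le_trans (ler_norm _) (fh _ Ax)) (le_trans (normr_ge0 _) (fh _ Ax)).
have [x Ax|r2 -> r2h] := part (fun x => (EFin \o f)^\- x)%E.
  rewrite funeneg_ge0/= funenegE ge_max !lee_fin.
  have fNh : - f x <= h x by rewrite (le_trans _ (fh _ Ax))// -normrN ler_norm.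
  by rewrite fNh (le_trans (normr_ge0 _) (fh _ Ax)).
exact: dist.
Qed.

(** The variable domain is absorbed by restricting [f] to a measurable subset of the plane;
    Tonelli's theorem then gives measurability of the partial integral. *)
Lemma measurable_Rintegral_section (D : T -> set T) (f : T * T -> R) :
  measurable [set z : T * T | D z.1 z.2] -> measurable_fun setT f ->
  (forall z, 0 <= f z) ->
  measurable_fun setT (fun s : T => \int[leb]_(y in D s) f (s, y)).
Proof.
move=> mD mf f0.
pose F (z : T * T) : \bar R := ((EFin \o f) \_ [set z : T * T | D z.1 z.2]) z.
have -> : (fun s => \int[leb]_(y in D s) f (s, y)) =
    fine \o (fubini_F leb F).
  apply/funext => s /=; rewrite /Rintegral /fubini_F integral_mkcond.
  by congr (fine _).
have F0 z : (0 <= F z)%E by apply: erestrict_ge0 => x _; rewrite lee_fin.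
have mF : measurable_fun setT F.
  apply/(measurable_restrictT _ _).1 => //.
  by apply/measurable_EFinP; exact: measurable_funTS.
have mFF := @measurable_fun_fubini_tonelli_F _ _ _ _ R leb F mF F0.
exact: (measurable_comp measurableT _ (fine_measurable measurableT) mFF).
Qed.

Lemma bounded_integrable_oo (x y : R) f B : measurable_fun setT f ->
  (forall z, x < z < y -> `|f z| <= B) -> leb.-integrable `]x, y[ (EFin \o f).
Proof.
move=> mf fB; apply: measurable_bounded_integrable => //.
- by rewrite /= lebesgue_measure_itv/=; case: ifP => // _; rewrite -EFinD ltry.
- exact: measurable_funTS.
- exists B; split => [|t Bt z /=]; first exact: num_real.
  by rewrite in_itv/= => /fB /le_trans; apply; exact: ltW.
Qed.

Lemma integrable_cst_oo (x y C : R) : leb.-integrable `]x, y[ (EFin \o cst C).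
Proof. by apply: (@bounded_integrable_oo _ _ _ `|C|) => // z _ /=. Qed.

Lemma Rintegral_cst_oo (x y C : R) : x <= y ->
  \int[leb]_(z in `]x, y[) C = C * (y - x).
Proof.
move=> xy; rewrite Rintegral_cst//=; congr (_ * _).
rewrite lebesgue_measure_itv/= lte_fin -EFinB; case: ltP => // yx.
by have -> : x = y; [apply/le_anti; rewrite xy|rewrite subrr].
Qed.

Lemma Rintegral_le_cst (x y C : R) f : x <= y ->
  leb.-integrable `]x, y[ (EFin \o f) -> (forall z, x < z < y -> f z <= C) ->
  \int[leb]_(z in `]x, y[) f z <= C * (y - x).
Proof.
move=> xy fi fC; rewrite -Rintegral_cst_oo//; apply: le_Rintegral => //.
exact: integrable_cst_oo.
Qed.

Lemma Rintegral_ge_cst (x y C : R) f : x <= y ->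
  leb.-integrable `]x, y[ (EFin \o f) -> (forall z, x < z < y -> C <= f z) ->
  C * (y - x) <= \int[leb]_(z in `]x, y[) f z.
Proof.
move=> xy fi fC; rewrite -Rintegral_cst_oo//; apply: le_Rintegral => //.
exact: integrable_cst_oo.
Qed.

End Integrals.

(** * Measurability in the point and in the shift *)

Lemma Vh_measurable (R : realType) (a b delta : R) (M : mesh a b delta) k
    (v : R -> R) : Vh M k v ->
  measurable_fun [set: measurableTypeR R] (v : measurableTypeR R -> R).
Proof. by case=> /sub_Lfun_mfun; rewrite inE. Qed.

Section Measurability.
Context {R : realType} {a b delta : R}.
Local Notation T := (measurableTypeR R).
Variables (M : mesh a b delta) (v : R -> R).
Hypothesis mv : measurable_fun [set: T] (v : T -> R).

Lemma measurable_g j :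
  measurable_fun [set: T * T] (fun z : T * T => g M v j z.2 z.1 : R).
Proof.
have m1 : measurable_fun [set: T * T] (fun z : T * T => z.1 : R).
  exact: measurable_fst.
have m2 : measurable_fun [set: T * T] (fun z : T * T => z.2 : R).
  exact: measurable_snd.
have msd : measurable_fun [set: T * T] (fun z : T * T => shift_diff z.1 v z.2 : R).
  apply: measurable_funB; last exact: (measurableT_comp mv m2).
  exact: (measurableT_comp mv (measurable_funD m2 m1)).
rewrite /g; apply: measurable_fun_ifT => //; last by apply: measurable_funB.
rewrite (_ : (fun _ => _) = fun z : T * T =>
    ((node M j.+1 - z.1 < z.2) && (z.2 < node M j.+1)) &&
    ((0 < z.1) && (z.1 < hhat M))); last first.
  by apply/funext => z; rewrite /cell2 mem_setE in_itv.
apply: measurable_and; apply: measurable_and; apply: measurable_fun_ltr => //.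
exact: measurable_funB.
Qed.

Lemma measurable_g_cell2 j (f : R -> R) : measurable_fun [set: R] f ->
  (forall x, 0 <= f x) ->
  measurable_fun [set: T]
    (fun s : T => \int[leb]_(y in cell2 M j s) f (g M v j y s)).
Proof.
move=> mf f0.
apply: (@measurable_Rintegral_section R (fun s => cell2 M j s)
  (fun z : T * T => f (g M v j z.2 z.1))) => //.
  rewrite (_ : [set z | _] = [set z : T * T | node M j.+1 - z.1 < z.2] `&`
     [set z : T * T | z.2 < node M j.+1]); last first.
    apply/seteqP; split => z /=; rewrite /cell2/= in_itv/=.
      by move=> /andP[].
    by move=> [-> ->].
  have m1 : measurable_fun [set: T * T] (fun z : T * T => node M j.+1 - z.1 : R).
    by apply: measurable_funB => //; exact: measurable_fst.
  have m2 : measurable_fun [set: T * T] (fun z : T * T => z.2 : R).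
    exact: measurable_snd.
  apply: measurableI; rewrite -[X in measurable X]setTI.
    exact: (measurable_fun_ltr m1 m2 measurableT (Y := [set true])).
  exact: (measurable_fun_ltr m2 (measurable_cst (node M j.+1)) measurableT
    (Y := [set true])).
exact: (measurableT_comp mf (measurable_g j)).
Qed.

Lemma measurable_g_cell j (f : R -> R) : measurable_fun [set: R] f ->
  (forall x, 0 <= f x) ->
  measurable_fun [set: T]
    (fun s : T => \int[leb]_(y in cell M j) f (g M v j y s)).
Proof.
move=> mf f0.
apply: (@measurable_Rintegral_section R (fun s => cell M j)
  (fun z : T * T => f (g M v j z.2 z.1))) => //.
  rewrite (_ : [set z | _] = setT `&` snd @^-1` cell M j); last first.
    by apply/seteqP; split => z //= -[].
  by apply: measurable_snd => //; exact: measurable_itv.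
exact: (measurableT_comp mf (measurable_g j)).
Qed.

Lemma measurable_g_section j s (f : R -> R) : measurable_fun [set: R] f ->
  measurable_fun [set: T] (fun y : T => f (g M v j y s)).
Proof.
move=> mf; apply: (measurableT_comp mf).
have ms : measurable_fun [set: T] (fun y : T => (s : T, y)).
  exact: measurable_fun_pair.
exact: (measurableT_comp (measurable_g j) ms).
Qed.

End Measurability.

(** * Integrability against a kernel that may be singular at the origin *)

Section Kernel.
Context {R : realType}.
Local Notation leb := (@lebesgue_measure R).
Variables (delta : R) (gamma : R -> R).
Hypothesis hk : is_kernel delta gamma.

Lemma kernel_ge0 s : 0 <= gamma s.
Proof. by case: hk. Qed.

Lemma measurable_inv_oo (x : R) : measurable_fun `]0, x[ (fun s : R => s^-1).
Proof.
apply: open_continuous_measurable_fun; first exact: interval_open.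
move=> s; rewrite inE/= in_itv/= => /andP[s0 _].
exact/inv_continuous/lt0r_neq0.
Qed.

Lemma kernel_integrable (x : R) : x <= delta ->
  leb.-integrable `]0, x[ (EFin \o (fun s => s ^+ 2 * gamma s)).
Proof.
move=> xd; case: hk => _ _ [mf _ hf] _.
have : leb.-integrable `[- delta, delta] (EFin \o (fun s => s ^+ 2 * gamma s)).
  apply/integrableP; split.
    by apply/measurable_EFinP; exact: measurable_funTS.
  by apply: hf => //; exact: segment_compact.
apply: integrableS => //.
move=> s /=; rewrite !in_itv/= => /andP[s0 sx]; apply/andP; split; lra.
Qed.

(** Measurability is given for [s ^+ 2 * gamma s]; away from the origin it can be divided by
    [s ^+ 2]. *)
Lemma kernel_measurable (x : R) : measurable_fun `]0, x[ gamma.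
Proof.
have [_ _ [mf _ _] _] := hk.
have h : measurable_fun `]0, x[
    (fun s : R => (s ^+ 2 * gamma s) * (s^-1 * s^-1) : R).
  apply: measurable_funM; first exact: measurable_funTS.
  by apply: measurable_funM; exact: measurable_inv_oo.
apply: eq_measurable_fun h => s; rewrite inE/= in_itv/= => /andP[s0 _].
by field; exact: lt0r_neq0.
Qed.

(** As [gamma] itself may fail to be integrable at 0, the other factor has to vanish there to second
    order; [C * s ^+ 2 * gamma s] is then an integrable majorant. *)
Lemma kernel_mul_integrable (F : R -> R) (C x : R) : x <= delta ->
  measurable_fun `]0, x[ F -> (forall s, 0 < s < x -> `|F s| <= C * s ^+ 2) ->
  leb.-integrable `]0, x[ (EFin \o (fun s => gamma s * F s)).
Proof.
move=> xd mF FC.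
apply: (@le_integrable _ _ _ leb _ _ _
   (fun s => (C%:E * (EFin \o (fun s => s ^+ 2 * gamma s)%R) s)%E)).
- exact: measurable_itv.
- by apply/measurable_EFinP; apply: measurable_funM => //; exact: kernel_measurable.
- move=> s; rewrite /= in_itv/= => sx; rewrite lee_fin normrM.
  rewrite ger0_norm ?kernel_ge0// mulrC (le_trans _ (ler_norm _))// mulrA.
  by rewrite ler_wpM2r ?kernel_ge0// FC.
- by apply: integrableZl; [exact: measurable_itv|exact: kernel_integrable].
Qed.

End Kernel.

(** * Comparison of the seminorms *)

Section Stability.
Context {R : realType} {a b delta : R}.
Local Notation T := (measurableTypeR R).
Variables (M : mesh a b delta) (v : R -> R) (B : R).
Local Notation n := (mesh_size M).
Local Notation leb := (@lebesgue_measure R).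
Hypotheses (ab : a < b) (d0 : 0 < delta).
Hypotheses (mv : measurable_fun [set: T] (v : T -> R)).
Hypothesis vB : forall y, `|v y| <= B.
Variables (c r : R) (L : nat -> R).
Hypotheses (c0 : 0 < c) (r0 : 0 < r) (Ln : L n = 0) (L0 : forall j, 0 <= L j).
Hypothesis hA : forall j s y, (j < n)%N -> 0 < s < hhat M -> cell2 M j s y ->
  `|g M v j y s| <= (L j + L j.+1) * s.
Hypothesis hB : forall j (s y : R), (j < n)%N -> 0 < s ->
  node M j < y -> y + s < node M j.+1 -> `|g M v j y s| <= L j * s.
Hypothesis hC : forall j, (j < n)%N -> exists alpha : R, [/\ node M j <= alpha,
  alpha + 2 * r * width M j <= node M j.+1 &
  forall s y : R, 0 < s <= r * width M j ->
    alpha < y < alpha + r * width M j -> c * L j * s <= `|g M v j y s|].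

Definition cell_energy j s := \int[leb]_(y in cell M j) (g M v j y s ^+ 2).
Definition cell2_energy j s := \int[leb]_(y in cell2 M j s) (g M v j y s ^+ 2).
Definition cell2_L1 j s := \int[leb]_(y in cell2 M j s) `|g M v j y s|.

Lemma g_integrable_oo (x y : R) j s (f : R -> R) (C : R) :
  measurable_fun [set: R] f ->
  (forall t, `|t| <= 2 * B + `|jump M v j| -> `|f t| <= C) ->
  leb.-integrable `]x, y[ (EFin \o (fun y => f (g M v j y s))).
Proof.
move=> mf fC; apply: (@bounded_integrable_oo _ _ _ _ C).
  exact: measurable_g_section.
by move=> z _; apply/fC/norm_g_le.
Qed.

Lemma g2_integrable (x y : R) j s :
  leb.-integrable `]x, y[ (EFin \o (fun y => g M v j y s ^+ 2)).
Proof.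
apply: (@g_integrable_oo _ _ _ _ (fun t => t ^+ 2) ((2 * B + `|jump M v j|) ^+ 2)).
  exact: measurable_funX.
by move=> t /sqr_le_norm; rewrite (@ger0_norm _ (t ^+ 2)) ?sqr_ge0.
Qed.

Lemma g1_integrable (x y : R) j s :
  leb.-integrable `]x, y[ (EFin \o (fun y => `|g M v j y s|)).
Proof.
apply: (@g_integrable_oo _ _ _ _ (fun t => `|t|) (2 * B + `|jump M v j|)) => //.
by move=> t; rewrite normr_id.
Qed.

Lemma cell_energy_ge0 j s : 0 <= cell_energy j s.
Proof. by apply: Rintegral_ge0 => y _; exact: sqr_ge0. Qed.

Lemma cell2_energy_ge0 j s : 0 <= cell2_energy j s.
Proof. by apply: Rintegral_ge0 => y _; exact: sqr_ge0. Qed.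

Lemma cell2_L1_ge0 j s : 0 <= cell2_L1 j s.
Proof. exact: Rintegral_ge0. Qed.

Lemma cell2_energy_le_cell j s : (j < n)%N -> s < hhat M ->
  cell2_energy j s <= cell_energy j s.
Proof.
move=> jn sh; apply: ge0_Rintegral_subset.
- exact: measurable_itv.
- exact: measurable_itv.
- exact: cell2_sub.
- exact: g2_integrable.
- by move=> y _; exact: sqr_ge0.
Qed.

Lemma cell2_Rintegral_le j s (f : R -> R) (C : R) : 0 <= s ->
  leb.-integrable `]node M j.+1 - s, node M j.+1[ (EFin \o f) ->
  (forall y, cell2 M j s y -> f y <= C) ->
  \int[leb]_(y in cell2 M j s) f y <= C * s.
Proof.
move=> s0 fi fC; have e : s = node M j.+1 - (node M j.+1 - s) by rewrite subKr.
rewrite [X in _ * X]e; apply: Rintegral_le_cst => //.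
by rewrite gerBl.
Qed.

Lemma cell2_L1_le j s : (j < n)%N -> 0 < s < hhat M ->
  cell2_L1 j s <= (L j + L j.+1) * s ^+ 2.
Proof.
move=> jn sh; rewrite expr2 mulrA; apply: cell2_Rintegral_le.
- by case/andP: sh => /ltW.
- exact: g1_integrable.
- by move=> y; exact: hA.
Qed.

Lemma cell2_energy_le j s : (j < n)%N -> 0 < s < hhat M ->
  cell2_energy j s <= ((L j + L j.+1) * s) ^+ 2 * s.
Proof.
move=> jn sh; apply: cell2_Rintegral_le.
- by case/andP: sh => /ltW.
- exact: g2_integrable.
- by move=> y yc; apply/sqr_le_norm/hA.
Qed.

(** The integral is restricted to the first half of the window from [hC], of length [r * width M j],
    where [g] is bounded below. *)
Lemma cell_energy_ge j s : (j < n)%N -> 0 < s <= r * width M j ->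
  (c * L j * s) ^+ 2 * (r * width M j) <= cell_energy j s.
Proof.
move=> jn sr; have [al [al1 al2 hal]] := hC jn.
have w0 := width_gt0 jn; have rw0 : 0 < r * width M j by rewrite mulr_gt0.
have e : r * width M j = al + r * width M j - al by rewrite addrAC subrr add0r.
apply: (@le_trans _ _
  (\int[leb]_(y in `]al, al + r * width M j[) (g M v j y s ^+ 2))).
  rewrite [X in _ * X <= _]e; apply: Rintegral_ge_cst.
  - by rewrite lerDl ltW.
  - exact: g2_integrable.
  - move=> y yal; apply: sqr_ge_norm (hal _ _ sr yal).
    by case/andP: sr => s0 _; rewrite !mulr_ge0// ltW.
apply: ge0_Rintegral_subset.
- exact: measurable_itv.
- exact: measurable_itv.
- move=> y; rewrite /cell/= !in_itv/= => /andP[y1 y2].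
  rewrite (le_lt_trans al1 y1)/=; apply: lt_le_trans al2.
  by apply: lt_trans y2 _; rewrite ltrD2l -mulrA; lra.
- exact: g2_integrable.
- by move=> y _; exact: sqr_ge0.
Qed.

(* The point at distance [s] from the right end of the cell is split off because
   its translate by [s] is a node, where the value of [v] is unconstrained. *)
Lemma cell_energy_le_small j s : (j < n)%N -> 0 < s < hhat M ->
  cell_energy j s <= ((L j + L j.+1) * s) ^+ 2 * width M j.
Proof.
move=> jn sh; have /andP[s0 sh'] := sh; set C := _ ^+ 2.
have sw : s < width M j.
  by rewrite (lt_le_trans sh')// (le_trans (hhat_le_rho M))// rho_le_width.
have wE := node_succE M j.
pose x := node M j.+1 - s.
have xj : node M j <= x by rewrite /x; lra.
have xj' : x < node M j.+1 by rewrite /x; lra.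
have GE : cell_energy j s = cell2_energy j s +
    \int[leb]_(y in `]node M j, x[) (g M v j y s ^+ 2).
  have := @Rintegral_itvB R (fun y => g M v j y s ^+ 2)
    (BRight (node M j)) (BLeft (node M j.+1)) x.
  rewrite -Rintegral_itv_bndo_bndc; last exact: g2_integrable.
  rewrite !bnd_simp => /(_ (g2_integrable _ _ _ _) xj xj')/eqP.
  by rewrite subr_eq => /eqP.
rewrite GE.
have h2 := cell2_energy_le jn sh.
have h1 : \int[leb]_(y in `]node M j, x[) (g M v j y s ^+ 2) <= C * (x - node M j).
  apply: Rintegral_le_cst => //; first exact: g2_integrable.
  move=> y /andP[y1 y2]; apply: sqr_le_norm.
  apply: le_trans (hB jn s0 y1 _) _; first by move: y2; rewrite /x; lra.
  by rewrite ler_wpM2r ?(ltW s0)// lerDl.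
apply: le_trans (lerD h2 h1) _.
by rewrite -mulrDr /x wE; rewrite (_ : s + _ = width M j)//; ring.
Qed.

Lemma cell_energy_le_large j s : (j < n)%N ->
  cell_energy j s <= (2 * B + `|jump M v j|) ^+ 2 * width M j.
Proof.
move=> jn; apply: Rintegral_le_cst.
- exact/ltW/node_incr.
- exact: g2_integrable.
- by move=> y _; apply/sqr_le_norm/norm_g_le.
Qed.

(** This is the second-order decay needed for the integrand of E. For [s < hhat] it comes from the
    Lipschitz bounds; for larger [s] the crude bound is multiplied by [(s / hhat) ^+ 2], which is at
    least 1. The constant depends on [v] and the mesh and is used for integrability only. *)
Lemma sum_cell_energy_le : 0 < hhat M -> exists2 C : R, 0 <= C &
  forall s, 0 < s -> \sum_(j < n) cell_energy j s <= C * s ^+ 2.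
Proof.
move=> hh0.
pose C1 := \sum_(j < n) (L j + L j.+1) ^+ 2 * width M j.
pose C2 := \sum_(j < n) (2 * B + `|jump M v j|) ^+ 2 * width M j.
have w0 (j : 'I_n) : 0 <= width M j by exact/ltW/width_gt0.
have C10 : 0 <= C1 by apply: sumr_ge0 => j _; rewrite mulr_ge0 ?sqr_ge0.
have C20 : 0 <= C2 by apply: sumr_ge0 => j _; rewrite mulr_ge0 ?sqr_ge0.
exists (C1 + C2 * (hhat M) ^- 2).
  by rewrite addr_ge0// mulr_ge0// invr_ge0 sqr_ge0.
move=> s s0; rewrite mulrDl; have [sh|sh] := ltP s (hhat M).
  rewrite ler_wpDr//.
    have h2 : 0 <= hhat M ^- 2 by rewrite invr_ge0 sqr_ge0.
    by rewrite mulr_ge0 ?sqr_ge0// mulr_ge0.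
  rewrite mulr_suml; apply: ler_sum => j _.
  apply: le_trans (cell_energy_le_small _ _) _ => //; first by rewrite s0.
  by rewrite exprMn mulrAC.
rewrite ler_wpDl//; first by rewrite mulr_ge0 ?sqr_ge0.
apply: le_trans (ler_sum _ (fun j _ => cell_energy_le_large s (ltn_ord j))) _.
rewrite -/C2 -mulrA ler_peMr// mulrC ler_pdivlMr ?exprn_gt0// mul1r.
by rewrite lerXn2r ?nnegrE// ltW.
Qed.

(** Young's inequality is applied at each point with weight [k1 = eps * w / s], chosen to reproduce
    the weight of the J-seminorm. The remaining constant, integrated over an interval of length [s],
    yields the factor [s ^+ 2] of the P-seminorm, and [w >= rho] removes the dependence on the
    cell. *)
Lemma jump_young j (eps : R) s :
  0 < eps -> 0 < rho M -> (j < n)%N -> 0 < s < hhat M ->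
  `|jump M v j| * cell2_L1 j s <= eps * (width M j * (s^-1 * cell2_energy j s)) +
    jump M v j ^+ 2 / (4 * eps * rho M) * s ^+ 2.
Proof.
move=> e0 rh0 jn sh; have /andP[s0 _] := sh.
have w0 := width_gt0 jn; have rw := rho_le_width jn.
set J := jump M v j; set w := width M j.
have mc : measurable (cell2 M j s) by exact: measurable_itv.
pose k1 := eps * w * s^-1; have k10 : 0 < k1 by rewrite !mulr_gt0 ?invr_gt0.
pose k2 := J ^+ 2 / (4 * k1).
have mk1 : measurable_fun [set: R] (fun t : R => k1 * t ^+ 2).
  by apply: measurable_funM => //; exact: measurable_funX.
have mk : measurable_fun [set: R] (fun t : R => k1 * t ^+ 2 + k2).
  by apply: measurable_funD.
have bk (t : R) : `|t| <= 2 * B + `|J| ->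
    `|k1 * t ^+ 2| <= k1 * (2 * B + `|J|) ^+ 2.
  move=> tC; have kt0 : 0 <= k1 * t ^+ 2 by rewrite mulr_ge0 ?sqr_ge0// ltW.
  by rewrite (ger0_norm kt0) ler_pM2l// sqr_le_norm.
have -> : `|J| * cell2_L1 j s =
    \int[leb]_(y in cell2 M j s) (`|J| * `|g M v j y s|).
  by rewrite RintegralZl//; exact: g1_integrable.
apply: (@le_trans _ _ (\int[leb]_(y in cell2 M j s) (k1 * g M v j y s ^+ 2 + k2))).
  apply: le_Rintegral => //.
  - apply: (@g_integrable_oo _ _ _ _ (fun t => `|J| * `|t|)
      (`|J| * (2 * B + `|J|))).
      by apply: measurable_funM.
    by move=> t ht; rewrite normrM !normr_id ler_wpM2l.
  - apply: (@g_integrable_oo _ _ _ _ (fun t => k1 * t ^+ 2 + k2)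
      (k1 * (2 * B + `|J|) ^+ 2 + `|k2|)) => //.
    by move=> t ht; rewrite (le_trans (ler_normD _ _))// lerD2r bk.
  - move=> y _; rewrite -[g _ _ _ _ _ ^+ 2]real_normK ?num_real//.
    rewrite /k2 -[J ^+ 2]real_normK ?num_real//.
    set x := `|J|; set z := `|g _ _ _ _ _|.
    have -> : k1 * z ^+ 2 + x ^+ 2 / (4 * k1) =
        x * z + k1 * (z - x / (2 * k1)) ^+ 2.
      by field; exact: lt0r_neq0.
    by rewrite lerDl mulr_ge0 ?sqr_ge0// ltW.
rewrite RintegralD//; last 2 first.
- exact: (@g_integrable_oo _ _ _ _ (fun t => k1 * t ^+ 2)
    (k1 * (2 * B + `|J|) ^+ 2)).
- exact: integrable_cst_oo.
rewrite RintegralZl//; last exact: g2_integrable.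
have k2s : k2 * s <= J ^+ 2 / (4 * eps * rho M) * s ^+ 2.
  have -> : k2 * s = J ^+ 2 / (4 * eps * w) * s ^+ 2.
    by rewrite /k2 /k1; field; rewrite !lt0r_neq0.
  rewrite ler_wpM2r ?sqr_ge0// ler_wpM2l ?sqr_ge0//.
  by rewrite lef_pV2 ?posrE ?mulr_gt0// ler_pM2l ?mulr_gt0.
apply: lerD; first by rewrite /k1 -!mulrA.
by rewrite Rintegral_cst_oo ?gerBl ?(ltW s0)// subKr.
Qed.

(** The estimate is made after summation over the cells because [g] near the right end of a cell
    also sees the next piece, whose Lipschitz constant is controlled by the energy of the next
    cell. *)
Lemma sum_cell2_energy_le (nu : R) s :
  0 < nu -> nu * hmax M <= rho M -> 0 < rho M -> 0 < s < hhat M ->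
  \sum_(j < n) width M j * (s^-1 * cell2_energy j s) <=
    ((r * nu)^-1 + 2 * (1 + nu^-1) / (c ^+ 2 * r)) *
    \sum_(j < n) cell_energy j s.
Proof.
move=> nu0 hnu rh0 sh; have /andP[s0 sh'] := sh.
have SG0 : 0 <= \sum_(j < n) cell_energy j s.
  by apply: sumr_ge0 => j _; exact: cell_energy_ge0.
have w0 (j : 'I_n) : 0 < width M j by exact: width_gt0.
have nui0 : 0 < nu^-1 by rewrite invr_gt0.
have wnu (i j : 'I_n) : width M i <= nu^-1 * width M j.
  rewrite mulrC ler_pdivlMr// mulrC; apply: le_trans (rho_le_width (ltn_ord j)).
  by apply: le_trans hnu; rewrite ler_pM2l// width_le_hmax.
(* Each regime uses one summand of the constant and drops the other. Here [s <= r * rho], so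
   [cell_energy_ge] applies on every cell. *)
rewrite mulrDl; have [sr|sr] := leP s (r * rho M).
  rewrite ler_wpDl//; first by rewrite mulr_ge0// invr_ge0 mulr_ge0 ?ltW.
  pose beta j := width M j * L j ^+ 2.
  have beta_n : beta n = 0 by rewrite /beta Ln expr0n mulr0.
  have beta0 (j : 'I_n) : 0 <= beta j by rewrite mulr_ge0 ?sqr_ge0// ltW.
  (* The square of [L j + L j.+1] is split by [(x + y)^2 <= 2 x^2 + 2 y^2]; mesh regularity then
     trades the width of cell [j] for that of cell [j.+1] at the price [nu^-1]. *)
  have hG2 (j : 'I_n) : width M j * (s^-1 * cell2_energy j s) <=
      2 * s ^+ 2 * (beta j + nu^-1 * beta j.+1).
    apply: (@le_trans _ _ (width M j * (s^-1 * (((L j + L j.+1) * s) ^+ 2 * s)))).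
      by rewrite ler_pM2l// ler_pM2l ?invr_gt0// cell2_energy_le.
    have -> : width M j * (s^-1 * (((L j + L j.+1) * s) ^+ 2 * s)) =
        s ^+ 2 * (width M j * (L j + L j.+1) ^+ 2).
      by field; exact: lt0r_neq0.
    rewrite [leRHS](_ : _ = s ^+ 2 * (2 * (beta j + nu^-1 * beta j.+1))).
      2: by ring.
    rewrite ler_wpM2l ?sqr_ge0//.
    apply: (@le_trans _ _ (2 * (width M j * L j ^+ 2 + width M j * L j.+1 ^+ 2))).
      rewrite -subr_ge0 (_ : _ - _ = width M j * (L j - L j.+1) ^+ 2); last by ring.
      by rewrite mulr_ge0 ?sqr_ge0// ltW.
    rewrite ler_pM2l// lerD2l; have [j1n|nj] := ltnP j.+1 n.
      by rewrite /beta [leRHS]mulrA ler_wpM2r ?sqr_ge0// (wnu j (Ordinal j1n)).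
    have -> : j.+1 = n by apply/eqP; rewrite eqn_leq nj ltn_ord.
    by rewrite beta_n Ln expr0n !mulr0.
  apply: le_trans (ler_sum _ (fun j _ => hG2 j)) _.
  rewrite -mulr_sumr big_split/= -mulr_sumr.
  (* The shifted sum loses [beta 0], which is nonnegative, and gains [beta n], which is zero. *)
  have shift : \sum_(j < n) beta j.+1 <= \sum_(j < n) beta j.
    have beta00 : 0 <= beta 0%N.
      have [n0|n0] := posnP n; first by rewrite -n0 beta_n.
      exact: (beta0 (Ordinal n0)).
    have : \sum_(i < n.+1) beta i = beta 0%N + \sum_(i < n) beta i.+1.
      by rewrite big_ord_recl.
    by rewrite big_ord_recr/= beta_n addr0 => ->; rewrite lerDr.
  have hG : c ^+ 2 * r * s ^+ 2 * \sum_(j < n) beta j <=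
      \sum_(j < n) cell_energy j s.
    rewrite mulr_sumr; apply: ler_sum => j _.
    apply: le_trans (cell_energy_ge (ltn_ord j) _); last first.
      by rewrite s0 (le_trans sr)// ler_pM2l// rho_le_width.
    by rewrite /beta le_eqVlt; apply/orP; left; apply/eqP; ring.
  have cr0 : 0 < c ^+ 2 * r by rewrite mulr_gt0// exprn_gt0.
  apply: (@le_trans _ _ (2 * (1 + nu^-1) / (c ^+ 2 * r) *
      (c ^+ 2 * r * s ^+ 2 * \sum_(j < n) beta j))); last first.
    by rewrite ler_pM2l// !(mulr_gt0, invr_gt0)// addr_gt0.
  have -> : 2 * (1 + nu^-1) / (c ^+ 2 * r) *
      (c ^+ 2 * r * s ^+ 2 * \sum_(j < n) beta j) =
    2 * s ^+ 2 * (\sum_(j < n) beta j + nu^-1 * \sum_(j < n) beta j).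
    by field; rewrite !lt0r_neq0.
  have s20 : 0 <= 2 * s ^+ 2 by rewrite mulr_ge0// sqr_ge0.
  by apply: (ler_wpM2l s20); rewrite lerD2l ler_pM2l.
(* Now [s > r * rho]: the weight [width / s] is at most [hmax / (r * rho)], hence at most
   [1 / (r * nu)], and [cell2] is part of the cell. *)
have C20 : 0 <= 2 * (1 + nu^-1) / (c ^+ 2 * r).
  by rewrite ltW// !(mulr_gt0, invr_gt0)// ?exprn_gt0// addr_gt0.
have CS0 := mulr_ge0 C20 SG0.
apply: (@le_trans _ _ ((r * nu)^-1 * \sum_(j < n) cell_energy j s)).
  2: by rewrite lerDl.
rewrite mulr_sumr; apply: ler_sum => j _; rewrite mulrA.
apply: ler_pM.
- by rewrite divr_ge0// ltW.
- exact: cell2_energy_ge0.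
- rewrite ler_pdivrMr//; apply: (@le_trans _ _ ((r * nu)^-1 * (r * rho M))).
    rewrite (_ : _ * _ = nu^-1 * rho M); last by field; rewrite !lt0r_neq0.
    rewrite mulrC ler_pdivlMr// mulrC; apply: le_trans hnu.
    by rewrite ler_pM2l// width_le_hmax.
  by rewrite ler_pM2l ?invr_gt0 ?mulr_gt0// ltW.
- exact: cell2_energy_le_cell.
Qed.

(** * Integration in [s] against the kernel *)

Variable gamma : R -> R.
Hypothesis hk : is_kernel delta gamma.

Let mDh : measurable (`]0, hhat M[ : set R). Proof. exact: measurable_itv. Qed.
Let mDd : measurable (`]0, delta[ : set R). Proof. exact: measurable_itv. Qed.

Lemma measurable_cell_energy j : measurable_fun [set: R] (cell_energy j).
Proof.
apply: (@measurable_g_cell _ _ _ _ M v mv j (fun t => t ^+ 2)).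
  exact: measurable_funX.
by move=> t; exact: sqr_ge0.
Qed.

Lemma measurable_cell2_energy j : measurable_fun [set: R] (cell2_energy j).
Proof.
apply: (@measurable_g_cell2 _ _ _ _ M v mv j (fun t => t ^+ 2)).
  exact: measurable_funX.
by move=> t; exact: sqr_ge0.
Qed.

Lemma measurable_cell2_L1 j : measurable_fun [set: R] (cell2_L1 j).
Proof. exact: (@measurable_g_cell2 _ _ _ _ M v mv j (fun t => `|t|)). Qed.

Lemma E_integrable :
  leb.-integrable `]0, delta[
    (EFin \o (fun s => gamma s * \sum_(j < n) cell_energy j s)).
Proof.
have [C C0 hC0] := sum_cell_energy_le (hhat_gt0 M ab d0).
apply: (kernel_mul_integrable hk (C := C)) => //.
  apply: measurable_sum => j; apply: measurable_funTS.
  exact: measurable_cell_energy.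
move=> s /andP[s0 _]; rewrite ger0_norm ?hC0// sumr_ge0// => j _.
exact: cell_energy_ge0.
Qed.

Lemma J_integrable (j : 'I_n) :
  leb.-integrable `]0, hhat M[
    (EFin \o (fun s => gamma s * (s^-1 * cell2_energy j s))).
Proof.
apply: (kernel_mul_integrable hk (C := (L j + L j.+1) ^+ 2)).
- exact: hhat_le_delta.
- apply: measurable_funM; first exact: measurable_inv_oo.
  by apply: measurable_funTS; exact: measurable_cell2_energy.
- move=> s sh; have /andP[s0 _] := sh.
  rewrite ger0_norm ?mulr_ge0 ?invr_ge0 ?(ltW s0) ?cell2_energy_ge0//.
  rewrite ler_pdivrMl//; apply: le_trans (cell2_energy_le (ltn_ord j) sh) _.
  by rewrite exprMn mulrC.
Qed.

Lemma K_integrable (j : 'I_n) :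
  leb.-integrable `]0, hhat M[ (EFin \o (fun s => gamma s * cell2_L1 j s)).
Proof.
apply: (kernel_mul_integrable hk (C := L j + L j.+1)).
- exact: hhat_le_delta.
- by apply: measurable_funTS; exact: measurable_cell2_L1.
- move=> s sh; rewrite ger0_norm ?cell2_L1_ge0//.
  exact: (cell2_L1_le (ltn_ord j) sh).
Qed.

Lemma normE2E : normE2 M gamma v =
  2 * \int[leb]_(s in `]0, delta[) (gamma s * \sum_(j < n) cell_energy j s).
Proof. by []. Qed.

Lemma normJ2E : normJ2 M gamma v = 2 * \sum_(j < n) (width M j *
  \int[leb]_(s in `]0, hhat M[) (gamma s * (s^-1 * cell2_energy j s))).
Proof.
rewrite /normJ2; congr (_ * _); apply: eq_bigr => j _; congr (_ * _).
by apply: eq_Rintegral => s _; rewrite mulrA.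
Qed.

(** The bound [sum_cell2_energy_le] at fixed [s] is integrated against [gamma] over (0, hhat), and
    the nonnegative integrand of E allows the enlargement to (0, delta). The constant involves
    neither [gamma] nor [delta]. *)
Lemma normJ2_le_normE2 (nu : R) : 0 < nu -> nu * hmax M <= rho M ->
  normJ2 M gamma v <=
    ((r * nu)^-1 + 2 * (1 + nu^-1) / (c ^+ 2 * r)) * normE2 M gamma v.
Proof.
move=> nu0 hnu; set C := _ + _.
have C0 : 0 <= C.
  by rewrite ltW// addr_gt0// !(mulr_gt0, invr_gt0, addr_gt0)// ?exprn_gt0.
rewrite normJ2E normE2E mulrCA ler_pM2l//.
have Eh : leb.-integrable `]0, hhat M[
    (EFin \o (fun s => gamma s * \sum_(j < n) cell_energy j s)).
  apply: integrableS E_integrable => // s; rewrite /= !in_itv/= => /andP[-> sh].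
  exact: lt_le_trans (hhat_le_delta M).
have Jh (j : 'I_n) := integrable_scale (width M j) mDh (J_integrable j).
apply: (@le_trans _ _ (\int[leb]_(s in `]0, hhat M[)
    (C * (gamma s * \sum_(j < n) cell_energy j s)))).
  rewrite (eq_bigr (fun j : 'I_n => \int[leb]_(s in `]0, hhat M[)
    (width M j * (gamma s * (s^-1 * cell2_energy j s))))); last first.
    by move=> j _; rewrite RintegralZl//; exact: J_integrable.
  rewrite -Rintegral_sum//; apply: le_Rintegral => //.
  - rewrite (_ : _ \o _ = fun x => (\sum_(j < n) (EFin \o
      (fun s => width M j * (gamma s * (s^-1 * cell2_energy j s)))%R) x)%E).
      exact: integrable_sum.
    by apply/funext => x /=; rewrite sumEFin.
  - exact: integrable_scale.
  - move=> s; rewrite /= in_itv/= => sh.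
    under eq_bigr do rewrite mulrCA.
    rewrite -mulr_sumr [leRHS]mulrCA ler_wpM2l ?(kernel_ge0 hk)//.
    exact: (sum_cell2_energy_le nu0 hnu (rho_gt0 M ab) sh).
rewrite RintegralZl// ler_wpM2l//; apply: ge0_Rintegral_subset => //.
- move=> s; rewrite /= !in_itv/= => /andP[-> sh].
  exact: lt_le_trans (hhat_le_delta M).
- exact: E_integrable.
- move=> s _; rewrite mulr_ge0 ?(kernel_ge0 hk)// sumr_ge0// => j _.
  exact: cell_energy_ge0.
Qed.

Lemma K_form_le (eps : R) : 0 < eps ->
  `|K_form M gamma v v| <= eps * normJ2 M gamma v +
    (2 * eps * rho M)^-1 * normP2 M gamma v.
Proof.
move=> e0; have rh0 := rho_gt0 M ab.
set I2 := \int[leb]_(s in `]0, hhat M[) (s ^+ 2 * gamma s).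
have I2i := kernel_integrable hk (hhat_le_delta M).
pose Jj (j : 'I_n) :=
  \int[leb]_(s in `]0, hhat M[) (gamma s * (s^-1 * cell2_energy j s)).
have term (j : 'I_n) : `|jump M v j * \int[leb]_(s in `]0, hhat M[) (gamma s *
      \int[leb]_(y in cell2 M j s) g M v j y s)| <=
    eps * (width M j * Jj j) + jump M v j ^+ 2 / (4 * eps * rho M) * I2.
  set k := _ / (4 * eps * rho M).
  apply: (@le_trans _ _ (\int[leb]_(s in `]0, hhat M[)
      (`|jump M v j| * (gamma s * cell2_L1 j s)))).
    rewrite normrM RintegralZl//; last exact: K_integrable.
    (* The inner integral of the signed [g] has not been shown measurable in [s]; it suffices that
       its majorant [cell2_L1] is integrable against [gamma]. *)
    rewrite ler_wpM2l//; apply: norm_Rintegral_le => //; first exact: K_integrable.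
    move=> s _; rewrite normrM ger0_norm ?(kernel_ge0 hk)//.
    rewrite ler_wpM2l ?(kernel_ge0 hk)//; apply: norm_Rintegral_le => //.
      exact: g1_integrable.
    exact: measurable_itv.
  have iJ := integrable_scale eps mDh
    (integrable_scale (width M j) mDh (J_integrable j)).
  have iP := integrable_scale k mDh I2i.
  have -> : eps * (width M j * Jj j) + k * I2 =
    \int[leb]_(s in `]0, hhat M[)
      (eps * (width M j * (gamma s * (s^-1 * cell2_energy j s))) +
       k * (s ^+ 2 * gamma s)).
    rewrite RintegralD// !RintegralZl//; first exact: J_integrable.
    exact: integrable_scale (J_integrable j).
  apply: le_Rintegral => //.
  - by apply: integrable_scale => //; exact: K_integrable.
  - exact: (@integrableD _ _ _ leb _ mDh _ _ iJ iP).
  - move=> s; rewrite /= in_itv/= => sh.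
    have := jump_young e0 rh0 (ltn_ord j) sh; rewrite -/k => hy.
    rewrite mulrCA.
    have -> : eps * (width M j * (gamma s * (s^-1 * cell2_energy j s))) + k * (s ^+ 2 * gamma s)
      = gamma s * (eps * (width M j * (s^-1 * cell2_energy j s)) + k * s ^+ 2) by ring.
    by rewrite ler_wpM2l ?(kernel_ge0 hk).
rewrite /K_form normrM ger0_norm//.
apply: (@le_trans _ _ (2 * \sum_(j < n)
    (eps * (width M j * Jj j) + jump M v j ^+ 2 / (4 * eps * rho M) * I2))).
  rewrite ler_pM2l//; apply: le_trans (ler_norm_sum _ _ _) _.
  by apply: ler_sum => j _; exact: term.
rewrite big_split/= -mulr_sumr -mulr_suml -mulr_suml normJ2E /normP2 /P_form -/I2.
rewrite le_eqVlt; apply/orP; left; apply/eqP.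
have -> : \sum_(j < n) jump M v j * jump M v j = \sum_(j < n) jump M v j ^+ 2.
  by apply: eq_bigr => j _; rewrite expr2.
by field; rewrite !lt0r_neq0.
Qed.

End Stability.

(** * Choice of the constants and absorption of the form J *)

Unset Implicit Arguments.
Set Strict Implicit.

Theorem mainTheorem4 (R : realType) (nu : R) (k : nat) (nu_gt0 : 0 < nu) :
  exists kappa Cs : R, [/\ 0 < kappa, 0 < Cs &
    forall (a b delta : R) (gamma : R -> R) (M : mesh a b delta) (mu : R),
      a < b -> 0 < delta -> is_kernel delta gamma ->
      nu * hmax M <= rho M ->
      kappa * (rho M)^-1 <= mu ->
      forall v : R -> R, Vh M k v ->
        B_nIP M gamma mu v v >= Cs * triple_norm2 M gamma mu v /\
        B_nNIPG M gamma mu v v >= Cs * triple_norm2 M gamma mu v].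
Proof.
have [c [r [c0 r0 Hg]]] := Vh_g_bounds R k.
pose C := (r * nu)^-1 + 2 * (1 + nu^-1) / (c ^+ 2 * r).
have C0 : 0 < C.
  by rewrite addr_gt0// !(mulr_gt0, invr_gt0, addr_gt0)// ?exprn_gt0.
(* With [eps = 1 / (4 * C)], the bound [J <= C * E] gives [eps * J <= E / 4], and the P-term of
   [K_form_le] becomes [(8 * C / rho) * P / 4], at most [mu * P / 4] by the choice of [kappa]. Then
   [2 * K] costs at most half of [E + mu * P], while the triple norm is at most
   [(1 + C) * (E + mu * P)]; this gives [Cs]. *)
exists (8 * C), (2 * (1 + C))^-1; split.
- by rewrite mulr_gt0.
- by rewrite invr_gt0 mulr_gt0// addr_gt0.
move=> a b delta gamma M mu ab d0 hk hnu hmu v hv.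
have [L [Ln L0 hA hB hC]] := Hg a b delta M v ab d0 hv.
have [B vB] := Vh_bounded hv d0.
have mv := Vh_measurable hv.
have rh0 := rho_gt0 M ab.
have JE := normJ2_le_normE2 ab d0 mv vB c0 r0 Ln L0 hA hB hC hk nu_gt0 hnu.
rewrite -/C in JE.
have eps0 : 0 < (4 * C)^-1 by rewrite invr_gt0 mulr_gt0.
have K := K_form_le ab mv vB hA hk eps0.
have P0 : 0 <= normP2 M gamma v.
  apply: mulr_ge0; last by apply: sumr_ge0 => j _; rewrite -expr2 sqr_ge0.
  by apply: Rintegral_ge0 => s _; rewrite mulr_ge0 ?sqr_ge0 ?(kernel_ge0 hk).
have E0 : 0 <= normE2 M gamma v.
  rewrite normE2E mulr_ge0//; apply: Rintegral_ge0 => s _.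
  by rewrite mulr_ge0 ?(kernel_ge0 hk)// sumr_ge0// => j _; exact: cell_energy_ge0.
rewrite /B_nIP /B_nNIPG /J_nIP /J_nNIPG /triple_norm2.
rewrite -[E_form _ _ _ _]/(normE2 M gamma v) -[P_form _ _ _ _]/(normP2 M gamma v).
set E := normE2 _ _ _ in JE K E0 *; set J := normJ2 _ _ _ in JE K *.
set P := normP2 _ _ _ in K P0 *; set KK := K_form _ _ _ _ in K *.
(* With equal arguments the two K-terms of nNIPG cancel. *)
rewrite subrr addr0.
have muP : 8 * C * (rho M)^-1 * P <= mu * P by rewrite ler_wpM2r.
have muP0 : 0 <= mu * P.
  apply: le_trans muP; apply: mulr_ge0 => //.
  by rewrite !mulr_ge0 ?invr_ge0 ?ltW.
have bound : (2 * (1 + C))^-1 * (E + J + mu * P) <= (E + mu * P) / 2.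
  have C20 : 0 < 2 * (1 + C) by rewrite mulr_gt0// ltr_pwDl// ltW.
  rewrite ler_pdivrMl//.
  have -> : 2 * (1 + C) * ((E + mu * P) / 2) = E + C * E + mu * P + C * (mu * P).
    by field.
  have := mulr_ge0 (ltW C0) muP0; lra.
have absorb (e x y : R) : 0 <= e -> 0 <= x -> `|y| <= e / 4 + x / 4 ->
    (e + x) / 2 <= e + (y + y) + x.
  by move=> e0 x0; rewrite ler_norml => /andP[? _]; lra.
split; apply: le_trans bound _; last first.

  (* The nNIPG case is the absorption step with 0 in place of [K]. *)
  rewrite -[E in leRHS]addr0 -[0 in leRHS](addr0 0); apply: absorb => //.
  by rewrite normr0 addr_ge0// divr_ge0.
apply: absorb => //; apply: le_trans K _; apply: lerD.
  rewrite ler_pdivrMl ?mulr_gt0//; apply: le_trans JE _.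
  by rewrite le_eqVlt; apply/orP; left; apply/eqP; field.
have -> : (2 * (4 * C)^-1 * rho M)^-1 * P = 8 * C * (rho M)^-1 * P / 4.
  by field; rewrite !lt0r_neq0.
by rewrite ler_pM2r ?invr_gt0.
Qed.
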